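(* Let $\mathcal{L} \subset \mathbb{P}^{2}_{\mathbb{C}}$ be an $M$-arrangement of $d$ lines. \begin{enumerate} \item[a)] If $d\geq 9$ is odd, then $$\dfrac{c_{1}^{2}(U_{\mathcal{L}})}{c_{2}(U_{\mathcal{L}})} \leq \frac{11}{4}.$$ \item[b)] If $d\geq 10$ is even, then $$\dfrac{c_{1}^{2}(U_{\mathcal{L}})}{c_{2}(U_{\mathcal{L}})} \leq \frac{14}{5}.$$ \end{enumerate}
   Context: A line arrangement of $d$ lines is a finite set of $d$ distinct lines in the projective plane. An intersection point is $k$-fold (has multiplicity $k$) if exactly $k$ lines of the arrangement pass through it; $n_k$ denotes the number of $k$-fold intersection points. $M$-arrangement (also: $M$-line arrangement): an arrangement of $d$ lines in $\mathbb{P}^2_{\mathbb{C}}$ all of whose intersection points have multiplicity $2$, $3$ or $4$ (not all of these need occur), such that either $d=2m+1\geq 5$ is odd and $$n_2+4n_3+9n_4=3m^2+1,$$ or $d=2m\geq 4$ is even and $$n_2+4n_3+9n_4=3m^2-3m+3.$$ The log-surface $U_{\mathcal{L}}$: for an arrangement $\mathcal{L}$ of $d\geq 6$ lines with $n_d=0$, let $\pi:X\to\mathbb{P}^2_{\mathbb{C}}$ be the blowing up of the complex projective plane along all singular points of $\mathcal{L}$ of multiplicity $\geq 3$, let $\widetilde{\mathcal{L}}$ be the reduced total transform of $\mathcal{L}$, and let $U_{\mathcal{L}}=X\setminus\widetilde{\mathcal{L}}$ be the log-surface associated with $(X,\widetilde{\mathcal{L}})$. Its (logarithmic) Chern numbers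 are given by $$c_{1}^{2}(U_{\mathcal{L}}) = 9 - 5d + \sum_{k\geq 2}(3k-4)n_{k},\qquad c_{2}(U_{\mathcal{L}}) = 3 - 2d + \sum_{k\geq 2}(k-1)n_{k}.$$ *)

(* Defs.v *)
From HB Require Import structures.
From mathcomp Require Import all_boot all_order all_algebra.
From mathcomp Require Import finmap complex.
From mathcomp Require Import classical_sets cardinality reals.

Set Implicit Arguments.
Unset Strict Implicit.
Unset Printing Implicit Defensive.
Import Order.TTheory GRing.Theory Num.Theory.
Local Open Scope ring_scope.

(** The complex projective plane P(C^3), with C := R[i]: points and lines are
    the linear subspaces of C^3 of dimension 1 and 2, so that Leibniz equality
    is equality of points and of lines. *)
Definition ppoint (R : realType) : choiceType :=
  {V : {vspace 'rV[R[i]]_3} | \dim V == 1%N}.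

Definition pline (R : realType) : choiceType :=
  {V : {vspace 'rV[R[i]]_3} | \dim V == 2%N}.

Definition incident (R : realType) (P : ppoint R) (l : pline R) : bool :=
  (val P <= val l)%VS.

Definition arrangement (R : realType) := {fset pline R}.

Definition multiplicity (R : realType) (L : arrangement R) (P : ppoint R) : nat :=
  #|` [fset l in L | incident P l]%fset |.

(** [fset_set] sends infinite sets to [fset0]; for [2 <= k], the only case used
    below, the set of [k]-fold points is finite since two distinct lines meet in
    one point. *)
Definition nb_points (R : realType) (L : arrangement R) (k : nat) : nat :=
  #|` fset_set [set P : ppoint R | multiplicity L P = k]%classic |.

Definition M_arrangement (R : realType) (L : arrangement R) : Prop :=
  let n k : int := (nb_points L k)%:Z in
  (forall P : ppoint R, (2 <= multiplicity L P)%N ->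
     multiplicity L P \in [:: 2; 3; 4]%N) /\
  exists m : nat,
    [/\ #|` L| = (2 * m + 1)%N, (5 <= #|` L|)%N
      & n 2%N + 4 * n 3%N + 9 * n 4%N = 3 * m%:Z ^+ 2 + 1]
    \/
    [/\ #|` L| = (2 * m)%N, (4 <= #|` L|)%N
      & n 2%N + 4 * n 3%N + 9 * n 4%N = 3 * m%:Z ^+ 2 - 3 * m%:Z + 3].

(** The logarithmic Chern numbers of U_L = X \ L~, where X is the blow-up of the
    plane at the points of multiplicity at least 3 of L and L~ is the reduced
    total transform of L, given by their combinatorial formulas. These are
    meaningful when L has at least 6 lines, not all concurrent. The sums over
    all k >= 2 stop at the number of lines, which bounds every multiplicity. *)
Definition log_c1_sq (R : realType) (L : arrangement R) : int :=
  9 - 5 * #|` L|%:Z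
  + \sum_(2 <= k < #|` L|.+1) (3 * k%:Z - 4) * (nb_points L k)%:Z.

Definition log_c2 (R : realType) (L : arrangement R) : int :=
  3 - 2 * #|` L|%:Z
  + \sum_(2 <= k < #|` L|.+1) (k%:Z - 1) * (nb_points L k)%:Z.

(* Main.v *)
(** Two distinct lines meet in exactly one point, so counting ordered pairs of
    distinct lines by their intersection point gives
    [\sum_k k (k - 1) n_k = d (d - 1)]. Together with the defining equation of
    an M-arrangement this expresses [n_2] and [n_3], hence both Chern numbers,
    through [m] and [n_4]: for [d = 2m + 1],
    [n_2 = 3 n_4 - (m - 1) (m - 3)], [c_2 = m (m - 2)] and
    [c_1^2 = 3 m^2 - 7 m + 3 - n_4]; for [d = 2m],
    [n_2 = 3 n_4 - (m^2 - 5 m + 9)], [c_2 = m (m - 3)] and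
    [c_1^2 = 3 m^2 - 10 m + 6 - n_4]. Since [0 <= n_2] bounds [n_4] from below,
    the slope inequalities reduce to [0 <= (m + 6) (m - 4)] and
    [0 <= (2 m + 9) (m - 5)] respectively. *)
Require Import Defs.
From HB Require Import structures.
From mathcomp Require Import all_boot all_order all_algebra.
From mathcomp Require Import finmap complex.
From mathcomp Require Import classical_sets cardinality reals.
From mathcomp Require Import zify.

Set Implicit Arguments.
Unset Strict Implicit.
Unset Printing Implicit Defensive.
Import Order.TTheory GRing.Theory Num.Theory.
Local Open Scope ring_scope.

(** A line is a nonzero subspace, so [vpick] yields a nonzero vector of it; its span serves as the
    default of [meet_point]. *)
Lemma dim_vpick_pline (R : realType) (l : pline R) :
  \dim <[vpick (val l)]>%VS == 1%N.
Proof.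
rewrite dim_vline vpick0; case: (val l =P 0%VS) => // l0.
by have := valP l; rewrite /= l0 dimv0.
Qed.

(** The default value, taken when [l1 = l2], is some point of [l1]. *)
Definition meet_point (R : realType) (l1 l2 : pline R) : ppoint R :=
  insubd (Sub <[vpick (val l1)]>%VS (dim_vpick_pline l1) : ppoint R)
    (val l1 :&: val l2)%VS.

(** Two planes in a 3-space: their sum has dimension at most 3, so the intersection has dimension at
    least 1, and dimension 2 would make both equal to it. *)
Lemma dim_cap_pline (R : realType) (l1 l2 : pline R) :
  l1 != l2 -> \dim (val l1 :&: val l2) = 1%N.
Proof.
move=> neq_l; have [d1 d2] := (eqP (valP l1), eqP (valP l2)).
have dS : (\dim (val l1 + val l2) <= 3)%N.
  by rewrite (leq_trans (dimvS (subvf _))) // dimvf dim_matrix.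
have := dimv_sum_cap (val l1) (val l2).
have := dimvS (capvSl (val l1) (val l2)).
have : \dim (val l1 :&: val l2) <> 2%N.
  move=> dI; case/eqP: neq_l; apply: val_inj.
  have /eqP <- : (val l1 :&: val l2)%VS == val l1.
    by rewrite eqEdim capvSl dI d1.
  by apply/eqP; rewrite eqEdim capvSr dI d2.
move: d1 d2 dS; rewrite /=; lia.
Qed.

Lemma incident_meet (R : realType) (P : ppoint R) (l1 l2 : pline R) :
  l1 != l2 -> incident P l1 && incident P l2 = (meet_point l1 l2 == P).
Proof.
move=> neq_l; have dI := dim_cap_pline neq_l.
rewrite /incident -subv_cap -val_eqE /meet_point /= val_insubd dI eqxx.
by rewrite [RHS]eq_sym eqEdim (eqP (valP P)) dI andbT.
Qed.

Lemma in_fset_filter (T : choiceType) (A : {fset T}) (p : pred T) (x : T) :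
  (x \in [fset y in A | p y]%fset) = (x \in A) && p x.
Proof. by rewrite !inE. Qed.

Definition distinct_pairs (T : choiceType) (A : {fset T}) : {fset T * T} :=
  [fset p in (A `*` A)%fset | p.1 != p.2]%fset.

Lemma in_distinct_pairs (T : choiceType) (A : {fset T}) (p : T * T) :
  (p \in distinct_pairs A) = [&& p.1 \in A, p.2 \in A & p.1 != p.2].
Proof. by rewrite in_fset_filter in_fsetM andbA. Qed.

Lemma card_distinct_pairs (T : choiceType) (A : {fset T}) :
  #|` distinct_pairs A| = (#|` A| * #|` A|.-1)%N.
Proof.
have -> : #|` distinct_pairs A|
    = size [seq p <- [seq (x, y) | x <- A, y <- A] | p.1 != p.2].
  apply/perm_size/uniq_perm => [||[x y]].
  - exact: fset_uniq.
  - by rewrite filter_uniq // allpairs_uniq // => -[? ?] [].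
  - rewrite in_distinct_pairs mem_filter /= andbA andbC; congr andb.
    apply/andP/allpairsP => [[xA yA]|[[x' y'] [? ? [-> ->]]] //].
    by exists (x, y).
rewrite -sum1_size big_filter big_mkcond big_allpairs_dep /=.
under eq_big_seq => x xA.
  rewrite -big_mkcond big_fset_condE /= -card_fset_sum1.
  have -> : [fset y in A | x != y]%fset = (A `\ x)%fset.
    by apply/fsetP => y; rewrite in_fset_filter in_fsetD1 andbC eq_sym.
  have -> : #|` A `\ x|%fset = #|` A|.-1 by rewrite [in RHS](cardfsD1 x) xA.
  over.
by rewrite big_const_seq count_predT iter_addn_0 mulnC.
Qed.

(** All points of multiplicity at least 2. Taking them as an image of the finite set of pairs makes
    their finiteness automatic. *)
Definition double_points (R : realType) (L : arrangement R) : {fset ppoint R} :=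
  [fset meet_point p.1 p.2 | p in distinct_pairs L]%fset.

Lemma in_double_points (R : realType) (L : arrangement R) (P : ppoint R) :
  (P \in double_points L) = (2 <= multiplicity L P)%N.
Proof.
apply/imfsetP/idP => [[[l1 l2] /=]|P2].
  rewrite in_distinct_pairs /= => /and3P[l1L l2L neq_l].
  move/esym/eqP; rewrite -incident_meet // => /andP[P1 P2].
  have <- : #|` [fset l1; l2]%fset| = 2%N by rewrite cardfs2 neq_l.
  apply/fsubset_leq_card/fsubsetP => l.
  rewrite in_fset2 in_fset_filter.
  by case/orP => /eqP->; rewrite ?l1L ?l2L ?P1 ?P2.
(* The [k] lines through [P] form [k * (k - 1)] ordered pairs, a positive number for [2 <= k]. *)
have : (0 < #|` distinct_pairs [fset l in L | incident P l]%fset|)%N.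
  by rewrite card_distinct_pairs muln_gt0; move: P2; rewrite /multiplicity; lia.
rewrite cardfs_gt0 => /fset0Pn[[l1 l2]].
rewrite in_distinct_pairs !in_fset_filter /=.
case/and3P => /andP[l1L P1] /andP[l2L P2'] neq_l.
exists (l1, l2); first by rewrite /= in_distinct_pairs l1L l2L.
by apply/esym/eqP; rewrite -incident_meet ?P1.
Qed.

Lemma nb_pointsE (R : realType) (L : arrangement R) (k : nat) :
  (2 <= k)%N ->
  nb_points L k = (\sum_(P <- double_points L) (multiplicity L P == k))%N.
Proof.
move=> k2; rewrite -big_mkcond /= big_fset_condE -card_fset_sum1 /nb_points.
rewrite -[X in _ = #|` X|]set_fsetK; congr #|` fset_set _|.
rewrite eqEsubset; split=> P /=; rewrite in_fset_filter in_double_points.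
  by move=> ->; rewrite k2 eqxx.
by move=> /andP[_ /eqP].
Qed.

(** Double counting: the ordered pairs of distinct lines are sorted by meeting point, and the fibre
    over [P] consists of the pairs of distinct lines through [P]. *)
Lemma sum_distinct_pairs (R : realType) (L : arrangement R) :
  (\sum_(P <- double_points L) multiplicity L P * (multiplicity L P).-1
   = #|` L| * #|` L|.-1)%N.
Proof.
rewrite -(card_distinct_pairs L) card_fset_sum1.
rewrite (partition_big_imfset _ (fun p => meet_point p.1 p.2)) /=.
apply: eq_bigr => P _; rewrite big_fset_condE /= -card_fset_sum1.
rewrite -card_distinct_pairs; congr #|` _|.
apply/fsetP => -[l1 l2]; rewrite [LHS]in_distinct_pairs [RHS]in_fset_filter.
rewrite in_distinct_pairs !in_fset_filter /=.
case: (eqVneq l1 l2) => [|neq_l]; rewrite ?andbF //= !andbT.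
by rewrite -incident_meet // andbACA.
Qed.

Lemma multiplicity_le (R : realType) (L : arrangement R) (P : ppoint R) :
  (multiplicity L P <= #|` L|)%N.
Proof.
by apply/fsubset_leq_card/fsubsetP => l; rewrite in_fset_filter => /andP[].
Qed.

(** After exchanging the sums, each point contributes only at the index [k] equal to its
    multiplicity. *)
Lemma sum_nb_points (R : realType) (L : arrangement R) :
  (\sum_(2 <= k < #|` L|.+1) k * k.-1 * nb_points L k
   = #|` L| * #|` L|.-1)%N.
Proof.
rewrite -sum_distinct_pairs.
under eq_big_nat => k /andP[k2 _] do rewrite nb_pointsE // big_distrr /=.
rewrite exchange_big /= big_seq [RHS]big_seq; apply: eq_bigr => P.
rewrite in_double_points => P2.
rewrite (bigD1_seq (multiplicity L P)) ?iota_uniq //=; last first.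
  by rewrite mem_index_iota P2 ltnS multiplicity_le.
rewrite eqxx muln1 big1 ?addn0 // => k; rewrite eq_sym => /negPf->.
by rewrite muln0.
Qed.

Lemma sum_nb_points_le4 (V : zmodType) (R : realType) (L : arrangement R)
    (F : nat -> V) :
  M_arrangement L -> (forall k, nb_points L k = 0%N -> F k = 0) ->
  \sum_(2 <= k < #|` L|.+1) F k = F 2%N + F 3%N + F 4%N.
Proof.
(* [d4] puts the indices 2, 3 and 4 in the range of the sum; for [5 <= k] there is no [k]-fold
   point. *)
move=> [hmult hd] F0; have d4 : (4 <= #|` L|)%N by case: hd => m [] []; lia.
do 3!(rewrite big_ltn; last by lia); rewrite !addrA.
rewrite [X in _ + X]big_nat_cond big1 ?addr0 // => k /andP[/andP[k5 _] _].
apply: F0; rewrite nb_pointsE ?big_seq ?big1 //; last by lia.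
move=> P; rewrite in_double_points => /hmult; rewrite !inE.
by case: (_ =P k) => // ->; lia.
Qed.
Arguments sum_nb_points_le4 [V R L] F.

Lemma pair_count (R : realType) (L : arrangement R) :
  M_arrangement L ->
  (2 * nb_points L 2 + 6 * nb_points L 3 + 12 * nb_points L 4
   = #|` L| * #|` L|.-1)%N.
Proof.
(* The identity is cast to [int], as [sum_nb_points_le4] takes values in a [zmodType]. *)
move=> hM; apply/eqP; rewrite -(eqr_nat int) -sum_nb_points natr_sum.
rewrite (sum_nb_points_le4 _ hM); first by apply/eqP; lia.
by move=> k ->; rewrite muln0.
Qed.

Lemma log_c1_sqE (R : realType) (L : arrangement R) :
  M_arrangement L ->
  log_c1_sq L = 9 - 5 * #|` L|%:Z + 2 * (nb_points L 2)%:Z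
    + 5 * (nb_points L 3)%:Z + 8 * (nb_points L 4)%:Z.
Proof.
move=> hM; rewrite /log_c1_sq (sum_nb_points_le4 _ hM); first by lia.
by move=> k ->; rewrite mulr0.
Qed.

Lemma log_c2E (R : realType) (L : arrangement R) :
  M_arrangement L ->
  log_c2 L = 3 - 2 * #|` L|%:Z + (nb_points L 2)%:Z
    + 2 * (nb_points L 3)%:Z + 3 * (nb_points L 4)%:Z.
Proof.
move=> hM; rewrite /log_c2 (sum_nb_points_le4 _ hM); first by lia.
by move=> k ->; rewrite mulr0.
Qed.

(** Clearing the positive denominators; [b != 0] ensures that the quotient is not the conventional
    value of division by zero. *)
Lemma ratio_le (a b p q : int) :
  0 < b -> 0 < q -> q * a <= p * b ->
  b != 0 /\ a%:~R / b%:~R <= p%:~R / q%:~R :> rat.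
Proof.
move=> b0 q0 le_ab; split; first by rewrite gt_eqF.
rewrite ler_pdivrMr ?ltr0z // mulrAC ler_pdivlMr ?ltr0z //.
by rewrite -!intrM ler_int mulrC.
Qed.

Theorem theorem5p1 (R : realType) (L : arrangement R) (d : nat)
    (hM : M_arrangement L) (hd : #|` L| = d) :
  ((9 <= d)%N -> odd d ->
     log_c2 L != 0 /\
     (log_c1_sq L)%:~R / (log_c2 L)%:~R <= 11 / 4 :> rat)
  /\
  ((10 <= d)%N -> ~~ odd d ->
     log_c2 L != 0 /\
     (log_c1_sq L)%:~R / (log_c2 L)%:~R <= 14 / 5 :> rat).
Proof.
have count := pair_count hM; have c1E := log_c1_sqE hM.
have c2E := log_c2E hM; case: hM => _ [m nE]; rewrite hd in count c1E c2E nE.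
split=> d_ge d_odd.
(* The parity of [d] selects the matching alternative of the definition. *)
- have dE : d = (2 * m + 1)%N by case: nE => -[]; lia.
  have [_ _ nE'] : [/\ d = (2 * m + 1)%N, (5 <= d)%N
      & (nb_points L 2)%:Z + 4 * (nb_points L 3)%:Z + 9 * (nb_points L 4)%:Z
        = 3 * m%:Z ^+ 2 + 1] by case: nE => // -[]; lia.
  have countZ : 2 * (nb_points L 2)%:Z + 6 * (nb_points L 3)%:Z
      + 12 * (nb_points L 4)%:Z = 4 * m%:Z ^+ 2 + 2 * m%:Z.
    by rewrite dE addn1 /= in count; nia.
  (* From [9 <= d], [4 <= m]. Then [c_2 = m^2 - 2m >= 2m > 0] and [(m + 6)(m - 4) = m^2 + 2m - 24 >=
     6m - 24 >= 0], so what remains is linear. *)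
  have m_sq : 4 * m%:Z <= m%:Z ^+ 2 by rewrite expr2 ler_wpM2r //; lia.
  by apply: (ratio_le (p := 11) (q := 4)); lia.
- have dE : d = (2 * m)%N by case: nE => -[]; lia.
  have [_ _ nE'] : [/\ d = (2 * m)%N, (4 <= d)%N
      & (nb_points L 2)%:Z + 4 * (nb_points L 3)%:Z + 9 * (nb_points L 4)%:Z
        = 3 * m%:Z ^+ 2 - 3 * m%:Z + 3] by case: nE => // -[]; lia.
  have countZ : 2 * (nb_points L 2)%:Z + 6 * (nb_points L 3)%:Z
      + 12 * (nb_points L 4)%:Z = 4 * m%:Z ^+ 2 - 2 * m%:Z.
    by rewrite dE in count; nia.
  (* Here [5 <= m], so [c_2 = m^2 - 3m >= 2m > 0] and [(2m + 9)(m - 5) = 2m^2 - m - 45 >= 9m - 45 >=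
     0]. *)
  have m_sq : 5 * m%:Z <= m%:Z ^+ 2 by rewrite expr2 ler_wpM2r //; lia.
  by apply: (ratio_le (p := 14) (q := 5)); lia.
Qed.
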